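(* The minimum distance of the $p$-ary code of points and lines of a translation generalised quadrangle of order $(s,t)$, with $s$ a power of the prime $p$, is $s+1$.
   Context: Translation generalised quadrangles: let $q$ be a power of a prime. An egg $\mathcal{E}$ in $\mathrm{PG}(2n+m-1,q)$ ($n,m\geq 1$) is a set of $q^m+1$ subspaces, each of dimension $n-1$, such that any three different elements span a $(3n-1)$-dimensional subspace, and each $E\in\mathcal{E}$ is contained in an $(n+m-1)$-dimensional subspace $T_E$ (the tangent space at $E$) which is disjoint from every element of $\mathcal{E}\setminus\{E\}$. Embed $\mathrm{PG}(2n+m-1,q)$ as a hyperplane $H_\infty$ in $\Pi\cong\mathrm{PG}(2n+m,q)$. The points of the incidence structure $T(\mathcal{E})$ are: (i) the points of $\Pi\setminus H_\infty$; (ii) the $(n+m)$-dimensional subspaces of $\Pi$ intersecting $H_\infty$ in a tangent space of $\mathcal{E}$; (iii) a symbol $(\infty)$. The lines are: (a) the $n$-dimensional subspaces of $\Pi$ intersecting $H_\infty$ in an element of $\mathcal{E}$; (b) the elements of $\mathcal{E}$. Incidence: $(\infty)$ is incident with all lines of type (b) and no line of type (a); a point of type (ii) is incident with the lines of type (a) contained in it and with the unique line of type (b) contained in it; a point of type (i) is incident with the lines of type (a) containing it and with no line of type (b). $T(\mathcal{E})$ is a generalised quadrangle of order $(s,t)=(q^n,q^m)$, i.e. every line has $s+1$ points, every point is on $t+1$ lines, two distinct points are on at most one common line, and for each point $P$ and line $L$ not through $P$ there is exactly one line through $P$ meeting $L$. Every translation generalised quadrangle is isomorphic to $T(\mathcal{E})$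 for some egg $\mathcal{E}$. The $p$-ary code of points and lines: let $N$ be the incidence matrix with rows indexed by lines and columns indexed by points; the code is the $\mathbb{F}_p$-span of the rows of $N$. Its minimum distance equals the smallest Hamming weight of a nonzero codeword. *)

(* Defs.v *)
From HB Require Import structures.
From mathcomp Require Import all_boot all_order all_algebra.

Set Implicit Arguments.
Unset Strict Implicit.
Unset Printing Implicit Defensive.

Import GRing.Theory.
Local Open Scope ring_scope.

(* Incidence structures are given by finite types P of points and L of lines
   and a boolean incidence relation [inc : P -> L -> bool]. *)

Record generalised_quadrangle (P L : finType) (inc : P -> L -> bool)
    (s t : nat) : Prop := GeneralisedQuadrangle {
  gq_points_on_line : forall l : L, #|[set x | inc x l]| = s.+1;
  gq_lines_on_point : forall x : P, #|[set l | inc x l]| = t.+1;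
  gq_partial_linear : forall (x y : P) (l k : L), x != y ->
    inc x l -> inc y l -> inc x k -> inc y k -> l = k;
  gq_projection : forall (x : P) (l : L), ~~ inc x l ->
    exists! k : L, inc x k /\ exists y : P, inc y k /\ inc y l
}.

Definition isomorphic (P L P' L' : Type)
    (inc : P -> L -> bool) (inc' : P' -> L' -> bool) : Prop :=
  exists (f : P -> P') (g : L -> L'),
    [/\ bijective f, bijective g & forall x l, inc' (f x) (g l) = inc x l].

(* Over a finite field, a vector space has finitely many subspaces. *)
Section FiniteVspace.

Import VectorInternalTheory.
Variables (F : finFieldType) (V : vectType F).

HB.instance Definition _ := [Countable of {vspace V} by <:].
HB.instance Definition _ := [Finite of {vspace V} by <:].

End FiniteVspace.

(* A projective subspace of dimension k is represented by the vector subspace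
   of dimension k + 1 underlying it; so projective disjointness is a zero
   intersection, and the empty subspace is 0.  Here W is the hyperplane at
   infinity H_oo = PG(2n+m-1, q), of vector dimension 2n + m, in the projective
   space Pi of V, and q = #|F|. *)
Section Egg.

Variables (F : finFieldType) (V : vectType F) (n m : nat).
Variables (W : {vspace V}) (E : {set {vspace V}}).

Definition tangent_space (X T : {vspace V}) : bool :=
  [&& (T <= W)%VS, \dim T == (n + m)%N, (X <= T)%VS
    & [forall Y in E, (Y != X) ==> ((T :&: Y)%VS == 0%VS)]].

Record egg : Prop := Egg {
  egg_dim_ambient : \dim W = (2 * n + m)%N;
  egg_card : #|E| = (#|F| ^ m).+1;
  egg_sub : forall X, X \in E -> (X <= W)%VS;
  egg_dim : forall X, X \in E -> \dim X = n;
  egg_span : forall X Y Z, X \in E -> Y \in E -> Z \in E ->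
    X != Y -> X != Z -> Y != Z -> \dim (X + Y + Z)%VS = (3 * n)%N;
  egg_tangent : forall X, X \in E -> exists T, tangent_space X T
}.

Definition is_affine_point (x : {vspace V}) : bool :=
  (\dim x == 1%N) && ~~ (x <= W)%VS.

Definition is_tangent_point (U : {vspace V}) : bool :=
  (\dim U == (n + m).+1) &&
  [exists X in E, tangent_space X (U :&: W)%VS].

Definition is_affine_line (M : {vspace V}) : bool :=
  (\dim M == n.+1) && ((M :&: W)%VS \in E).

Inductive TE_point : Type :=
  | AffinePoint of {x : {vspace V} | is_affine_point x}
  | TangentPoint of {U : {vspace V} | is_tangent_point U}
  | InfinityPoint.

Inductive TE_line : Type :=
  | AffineLine of {M : {vspace V} | is_affine_line M}
  | EggLine of {X : {vspace V} | X \in E}.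

Definition TE_inc (x : TE_point) (l : TE_line) : bool :=
  match x, l with
  | AffinePoint x, AffineLine M => (val x <= val M)%VS
  | AffinePoint _, EggLine _ => false
  | TangentPoint U, AffineLine M => (val M <= val U)%VS
  | TangentPoint U, EggLine X => (val X <= val U)%VS
  | InfinityPoint, AffineLine _ => false
  | InfinityPoint, EggLine _ => true
  end.

End Egg.

Definition translation_generalised_quadrangle (P L : finType)
    (inc : P -> L -> bool) (s t : nat) : Prop :=
  generalised_quadrangle inc s t /\
  exists (F : finFieldType) (V : vectType F) (n m : nat)
         (W : {vspace V}) (E : {set {vspace V}}),
    [/\ (0 < n)%N /\ (0 < m)%N, \dim {:V} = (2 * n + m).+1, egg n m W E
      & isomorphic inc (@TE_inc F V n m W E)].

Definition incidence_matrix (P L : finType) (inc : P -> L -> bool) (p : nat) :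
    'M['F_p]_(#|L|, #|P|) :=
  \matrix_(i < #|L|, j < #|P|) (inc (enum_val j) (enum_val i))%:R.

Definition code_points_lines (P L : finType) (inc : P -> L -> bool) (p : nat) :
    {pred 'rV['F_p]_#|P|} :=
  [pred c : 'rV['F_p]_#|P| | (c <= incidence_matrix inc p)%MS].

Arguments code_points_lines {P L} inc p.

Definition hamming_distance (K : eqType) (k : nat) (c d : 'rV[K]_k) : nat :=
  #|[set j | c 0 j != d 0 j]|.

Definition is_min_distance (K : eqType) (k : nat) (C : {pred 'rV[K]_k})
    (d : nat) : Prop :=
  (exists c1 c2, [/\ c1 \in C, c2 \in C, c1 != c2 & hamming_distance c1 c2 = d])
  /\ (forall c1 c2, c1 \in C -> c2 \in C -> c1 != c2 ->
        (d <= hamming_distance c1 c2)%N).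

(* Main.v *)
Require Import Defs.
From mathcomp Require Import all_boot all_order all_algebra all_field.

Set Implicit Arguments.
Unset Strict Implicit.
Unset Printing Implicit Defensive.

(** A codeword c = sum_l lam_l l satisfies (c, h) = sum_l lam_l for every h taking the value 1
  on each line.  Two families of such h are used, writing q = #|F|, s = q^n and
  N = dim W: the perps of points, and, for every coset a + D of a subspace D of W with
  dim D = N - n, the affine points of a + D together with (oo) and all type (ii) points
  on those egg elements X that meet D nontrivially.  (The affine line w + X meets a + D in one point
  if X and D are disjoint, otherwise in 0 or q^i points with i > 0.)

  Hence the sum of c over a + D depends only on D.  If it is nonzero for some D, each of the
  q^n cosets of D contains an affine support point; were there no others, c would vanish
  on the perp of (oo), which forces sum_l lam_l = 0 and then makes the sum over a + D vanish.
  If all these sums vanish and c is nonzero at an affine point v, then at most q^n - 1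
  other support points could be avoided by some v + D, a contradiction.  If c vanishes at all
  affine points, the perps alone give s + 1 support points by a direct argument, which uses
  s <= t; this last inequality holds because three egg elements span 3n <= 2n + m dimensions. *)

(** Choosing one related [b] for each [a] gives an injection. The main use is to bound a support
    from below. *)
Lemma leq_card_rel (T1 T2 : finType) (A : {set T1}) (B : {set T2})
    (R : T1 -> T2 -> Prop) :
  {in A, forall a, exists2 b, b \in B & R a b} ->
  {in A &, forall a a' b, R a b -> R a' b -> a = a'} -> #|A| <= #|B|.
Proof.
move=> Rex Rinj.
(* [option] supplies a default outside [A], since [T2] may be empty. *)
have /fin_all_exists[f fP] a : exists b : option T2,
    a \in A -> if b is Some b' then b' \in B /\ R a b' else False.
  have [aA|] := boolP (a \in A); last by exists None.
  by have [b bB Rab] := Rex a aA; exists (Some b).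
have finj : {in A &, injective f}.
  move=> a a' aA a'A; move: (fP a aA) (fP a' a'A).
  case: (f a) => // b [_ Rab]; case: (f a') => // b' [_ Rab'] [ebb'].
  by apply: (Rinj a a' aA a'A b) => //; rewrite ebb'.
have Some_inj : injective (@Some T2) by move=> x y [].
rewrite -(card_in_imset finj) -(card_imset (mem B) Some_inj).
apply/subset_leq_card/subsetP => y /imsetP[a aA ->].
by move: (fP a aA); case: (f a) => // b [bB _]; apply: imset_f.
Qed.

(** * Counting and avoidance in vector spaces over a finite field *)

Section FiniteVectorSpaces.

Import GRing.Theory.
Local Open Scope ring_scope.

Variables (F : finFieldType) (V : vectType F).
Implicit Types (U W D : {vspace V}) (v w : V).

Lemma card_set_vspace U : #|[set v : finvect_type V | (v : V) \in U]| = (#|F| ^ \dim U)%N.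
Proof.
rewrite cardsE; case: V U => T cT U.
by rewrite -(@card_vspace F (finvect_type (Vector.Pack cT)) cT U); apply: eq_card.
Qed.

Lemma card_parametrised_coset (T : finType) (A : {set T}) (f : T -> V) v0 U :
  {in A &, injective f} ->
  {in A, forall x, f x - v0 \in U} ->
  {in U, forall u, exists2 x, x \in A & f x = v0 + u} ->
  #|A| = (#|F| ^ \dim U)%N.
Proof.
move=> finj fU Uf.
pose h x : finvect_type V := f x - v0.
have hinj : {in A &, injective h}.
  by move=> x y xA yA /addIr; apply: finj.
rewrite -card_set_vspace -(card_in_imset hinj); apply: eq_card => u.
rewrite inE; apply/imsetP/idP => [[x xA ->]|/Uf[x xA fx]]; first exact: fU.
by exists x => //; rewrite /h fx addrAC subrr add0r.
Qed.

Lemma leq_card_vspace_image (T : finType) (A : {set T}) U (h : V -> T -> Prop) :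
  {in U, forall u, exists2 x, x \in A & h u x} ->
  {in U &, forall u v x, h u x -> h v x -> u = v} ->
  (#|F| ^ \dim U <= #|A|)%N.
Proof.
move=> hex hinj; rewrite -card_set_vspace.
apply: (@leq_card_rel _ _ _ _ (h : finvect_type V -> T -> Prop)) => [v|v w].
  by rewrite inE; apply: hex.
by rewrite !inE; apply: hinj.
Qed.

(** With [d = \dim D], the spaces [D] and [D + <[u]>] together hold at most
    [q^d + size s * q^(d+1) < q^(d+1+n)] vectors, too few to cover [W]. *)
Lemma vspace_avoid_lines W D (s : seq V) n :
  (size s < #|F| ^ n)%N -> (\dim D + n < \dim W)%N ->
  exists v, [/\ v \in W, v \notin D & {in s, forall u, v \notin D + <[u]>}%VS].
Proof.
move=> szs dimD; set q := #|F|.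
have q1 : (1 < q)%N by apply: finNzRing_gt1.
pose bad (r : seq V) := [set v : finvect_type V |
  ((v : V) \in D) || has (fun u => (v : V) \in (D + <[u]>)%VS) r].
have badP r : (#|bad r| <= q ^ \dim D + size r * q ^ (\dim D).+1)%N.
  elim: r => [|u r IHr].
    rewrite mul0n addn0 -card_set_vspace; apply: subset_leq_card.
    by apply/subsetP => v; rewrite !inE orbF.
  have -> : bad (u :: r) =
      [set v : finvect_type V | (v : V) \in (D + <[u]>)%VS] :|: bad r.
    by apply/setP => v; rewrite !inE /= orbCA.
  apply: leq_trans (leq_card_setU _ _) _.
  rewrite mulSn addnCA leq_add // card_set_vspace.
  rewrite leq_pexp2l ?(ltnW q1) //; apply: leq_trans (dimv_add_leqif _ _) _.
  by rewrite -addn1 leq_add2l dim_vline; case: (_ != _).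
have : exists v : finvect_type V, ((v : V) \in W) && (v \notin bad s).
  apply/existsP; apply: contraT => /existsPn Wbad.
  have: (#|[set v : finvect_type V | (v : V) \in W]| <= #|bad s|)%N.
    apply: subset_leq_card; apply/subsetP => v; rewrite inE => vW.
    by have := Wbad v; rewrite vW negbK.
  rewrite card_set_vspace => /leq_trans/(_ (badP s)); rewrite leqNgt => /negP[].
  apply: (@leq_trans (q ^ ((\dim D).+1 + n))%N); last first.
    by rewrite leq_pexp2l // ltnW.
  apply: (@leq_trans ((size s).+1 * q ^ (\dim D).+1)%N).
    by rewrite mulSn ltn_add2r ltn_exp2l.
  by rewrite expnD mulnC leq_pmul2l ?expn_gt0 ?(ltnW q1).
case=> v /andP[vW]; rewrite inE negb_or => /andP[vD /hasPn sP].
by exists v; split.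
Qed.

Lemma dim_add_vline D v : v \notin D -> \dim (D + <[v]>) = (\dim D).+1.
Proof.
move=> vD; rewrite dimv_disjoint_sum.
  by rewrite dim_vline (contraNneq _ vD) ?addn1 // => ->; rewrite mem0v.
apply/eqP; rewrite -subv0; apply/subvP => x; rewrite memv_cap memv0.
case/andP => xD /vlineP[a xE]; move: xD; rewrite xE.
by case: (eqVneq a 0) => [->|a0]; rewrite ?scale0r ?eqxx // rpredZeq (negPf a0) (negPf vD).
Qed.

(** [D] grows from 0 one dimension at a time, each time by a vector outside [D] and all [D +
    <[u]>]. *)
Lemma vspace_avoid W (s : seq V) n :
  (size s < #|F| ^ n)%N -> (n <= \dim W)%N -> 0 \notin s ->
  exists D, [/\ (D <= W)%VS, (\dim D + n = \dim W)%N & {in s, forall u, u \notin D}].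
Proof.
move=> szs nW s0.
suff H k : (k + n <= \dim W)%N ->
    exists D, [/\ (D <= W)%VS, \dim D = k & {in s, forall u, u \notin D}].
  have [D [DW dD sD]] := H (\dim W - n)%N ltac:(by rewrite subnK).
  by exists D; split; rewrite // dD subnK.
elim: k => [|k IHk] kW.
  exists 0%VS; split; rewrite ?sub0v ?dimv0 // => u us; rewrite memv0.
  by apply: contraNneq s0 => <-.
have [D [DW dD sD]] := IHk (ltnW kW).
have [|v [vW vD sv]] := @vspace_avoid_lines W D s n szs; first by rewrite dD.
have Dv : \dim (D + <[v]>) = k.+1 by rewrite dim_add_vline // dD.
exists (D + <[v]>)%VS; split=> //; first by rewrite subv_add DW -memvE.
(* If [u] fell into [D + <[v]>], its [v]-coefficient would be nonzero because [u] is not in [D];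
   solving for [v] puts [v] in [D + <[u]>]. *)
move=> u us; apply: contra (sv u us) => /memv_addP[d dDu [_ /vlineP[a ->] uE]].
have a0 : a != 0.
  by apply: contraNneq (sD u us) => a0; rewrite uE a0 scale0r addr0.
have -> : v = (- a^-1) *: d + a^-1 *: u.
  by rewrite uE scalerDr scalerA mulVf // scale1r addrA scaleNr addNr add0r.
by rewrite memv_add ?memvZ ?memv_line.
Qed.

(** [U] and [D] are complementary in [W]; splitting [w - v] as [u + d] yields the common point
    [v + u]. *)
Lemma cosets_meet W U D v w : (U <= W)%VS -> (D <= W)%VS ->
  (\dim U + \dim D = \dim W)%N -> (U :&: D == 0)%VS -> v \in W -> w \in W ->
  exists x, (x - v \in U) && (x - w \in D).
Proof.
move=> UW DW dW /eqP UD0 vW wW.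
have UDW : (U + D)%VS = W.
  apply/eqP; rewrite -(geq_leqif (dimv_leqif_eq _)) ?subv_add ?UW //.
  by rewrite dimv_disjoint_sum ?dW.
have : w - v \in (U + D)%VS by rewrite UDW memvB.
case/memv_addP => u uU [d dD e]; exists (v + u).
have -> : w = v + u + d by rewrite -addrA -e addrC subrK.
by rewrite opprD addrA subrr add0r rpredN dD addrAC subrr add0r uU.
Qed.

End FiniteVectorSpaces.

(** * Perps and dual functions in a generalised quadrangle *)

Section GeneralisedQuadrangles.

Import GRing.Theory.
Local Open Scope ring_scope.

Variables (P L : finType) (inc : P -> L -> bool) (s t : nat).
Hypothesis gq : generalised_quadrangle inc s t.

Definition collinear (x y : P) := [exists l, inc x l && inc y l].

Lemma collinearP x y : reflect (exists l, inc x l /\ inc y l) (collinear x y).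
Proof. by apply: (iffP existsP) => -[l] /andP; exists l. Qed.

Lemma collinear_sym x y : collinear x y = collinear y x.
Proof. by apply: eq_existsb => l; rewrite andbC. Qed.

Lemma collinear_on_line x y l : inc x l -> inc y l -> collinear x y.
Proof. by move=> xl yl; apply/collinearP; exists l. Qed.

Lemma collinear_refl x : collinear x x.
Proof.
have /card_gt0P[l] : (0 < #|[set l | inc x l]|)%N by rewrite (gq_lines_on_point gq).
by rewrite inE => xl; apply: (collinear_on_line xl xl).
Qed.

(** The projection axiom makes only the joining line unique. Two points of [l] collinear with [z]
    would both lie on it, so it would equal [l] and put [z] on [l]. *)
Lemma collinear_unique z l : ~~ inc z l ->
  exists2 y, inc y l & forall x, inc x l -> collinear z x = (x == y).
Proof.
move=> zl; have [k [[zk [y [yk yl]]] kU]] := gq_projection gq zl.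
exists y => // x xl; apply/collinearP/eqP => [[k' [zk' xk']]|->]; last by exists k.
have ekk' : k = k' by apply: kU; split=> //; exists x.
subst k'; apply: contraNeq zl => xy.
by rewrite (gq_partial_linear gq xy xl yl xk' yk).
Qed.

Lemma collinear_unique_eq z l x y : ~~ inc z l -> inc x l -> inc y l ->
  collinear z x -> collinear z y -> x = y.
Proof.
by move=> /collinear_unique[w _ wU] xl yl; rewrite !wU // => /eqP-> /eqP->.
Qed.

Lemma card_line_minus l x : inc x l -> #|[set y | inc y l] :\ x| = s.
Proof.
move=> xl; apply/eqP; rewrite -eqSS -(gq_points_on_line gq l).
by rewrite [X in _ == X](cardsD1 x) inE xl.
Qed.

Lemma exists_line_avoiding u z : (0 < t)%N -> u != z ->
  exists2 l, inc u l & ~~ inc z l.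
Proof.
move=> t_gt0 uz; have [l0 [ul0 _]] := collinearP _ _ (collinear_refl u).
have /card_gt0P[l] : (0 < #|[set l | inc u l] :\ l0|)%N.
  by have := gq_lines_on_point gq u; rewrite (cardsD1 l0) inE ul0 add1n => -[->].
rewrite !inE => /andP[ll0 ul].
have [zl0|] := boolP (inc z l0); last by exists l0.
exists l => //; apply: contra ll0 => zl; apply/eqP.
exact: (gq_partial_linear gq uz ul zl ul0 zl0).
Qed.

Variable K : fieldType.

Lemma dual_sum (lam : L -> K) (c h : P -> K) :
  (forall x, c x = \sum_l lam l * (inc x l)%:R) ->
  (forall l, \sum_(x | inc x l) h x = 1) ->
  \sum_x c x * h x = \sum_l lam l.
Proof.
move=> cE h1; under eq_bigr do rewrite cE mulr_suml.
rewrite exchange_big; apply: eq_bigr => l _ /=.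
rewrite -[RHS]mulr1 -[X in _ = _ * X](h1 l) mulr_sumr [RHS]big_mkcond; apply: eq_bigr => x _.
by case: inc; rewrite /= ?mulr0 ?mul0r ?mulr1.
Qed.

(** A line on [z] lies inside the perp of [z] and gives [s + 1 = 1]; any other line meets that perp
    in one point. *)
Lemma perp_line_sum z l : s%:R = 0 :> K ->
  \sum_(x | inc x l) (collinear z x)%:R = 1 :> K.
Proof.
move=> s0; have [zl|/collinear_unique[y yl yU]] := boolP (inc z l).
  rewrite (eq_bigr (fun=> 1)) => [|x xl]; last by rewrite (collinear_on_line zl).
  by rewrite sumr_const -[in LHS]cardsE (gq_points_on_line gq) -natr1 s0 add0r.
rewrite (bigD1 y) //= (yU y) // eqxx big1 ?addr0 // => x /andP[xl xy].
by rewrite (yU x) // (negPf xy).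
Qed.

Lemma perp_support_weight (c : P -> K) z kap : (0 < s <= t)%N ->
  (forall y, \sum_(x | collinear y x) c x = kap) ->
  (forall x, c x != 0 -> collinear z x) ->
  (exists x, c x != 0) -> (s < #|[set x | c x != 0%R]|)%N.
Proof.
move=> /andP[s0 st] cperp cz [x0 cx0].
(* No triangles: a support point is collinear with [z], so if it is also collinear with [u] it lies
   on the line [zu]. *)
have collinear_line u l x :
    inc z l -> inc u l -> u != z -> c x != 0 -> collinear u x -> inc x l.
  move=> zl ul uz cx ux; apply: contraNT uz => xl; apply/eqP.
  by apply: (collinear_unique_eq xl ul zl); rewrite collinear_sym ?cz.
(* If [c z] is not [kap], each of the [t + 1] lines on [z] carries another support point: for [u] on
   such a line, the sum over the perp of [u] sees only that line and cannot be [c z] alone. *)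
have [czk|cz_kap] := eqVneq (c z) kap; last first.
  apply: (@leq_trans t.+1); first by rewrite ltnS.
  rewrite -(gq_lines_on_point gq z).
  apply: (@leq_card_rel _ _ _ _ (fun l x => inc x l /\ x != z)) => [l|l k].
    rewrite inE => zl.
    have /card_gt0P[u] : (0 < #|[set y | inc y l] :\ z|)%N by rewrite card_line_minus.
    rewrite !inE => /andP[uz ul].
    have /existsP[x /and3P[cx xl xz]] : [exists x, [&& c x != 0, inc x l & x != z]].
      apply: contraT => /existsPn noX.
      have := cperp u; rewrite (bigD1 z) /= ?(collinear_on_line ul) //.
      rewrite big1 ?addr0 => [/eqP|x /andP[ux xz]]; first by rewrite (negPf cz_kap).
      apply/eqP; apply: contraT => cx; have := noX x.
      by rewrite cx xz (collinear_line _ _ _ zl ul uz cx ux).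
    by exists x; rewrite ?inE.
  rewrite !inE => zl zk x [xl xz] [xk _].
  exact: (gq_partial_linear gq xz xl zl xk zk).
(* If [c u] is not [kap], take a line [l] on [u] missing [z]. Each of its [s] other points is
   collinear with a support point besides [u] and [z], and no two share one, since such a point is
   off [l]. *)
have [/existsP[u /and3P[uz zu cu]]|/existsPn noU] :=
  boolP [exists u, [&& u != z, collinear z u & c u != kap]].
  have [l ul zl] := exists_line_avoiding (leq_trans s0 st) uz.
  have only_u y : inc y l -> collinear z y -> y = u.
    by move=> yl zy; apply: (collinear_unique_eq zl).
  pose S := [set x | c x != 0].
  have : (s <= #|(S :\ u) :\ z|)%N.
    rewrite -(card_line_minus ul).
    apply: (@leq_card_rel _ _ _ _ (fun y x => [/\ collinear y x, c x != 0 & x != u])) => [y|y y'].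
      rewrite !inE => /andP[yu yl].
      have zy : ~~ collinear z y by apply: contra yu => /(only_u y yl)/eqP.
      have /existsP[x /and3P[cx xu yx]] : [exists x, [&& c x != 0, x != u & collinear y x]].
        apply: contraT => /existsPn noX.
        have := cperp y; rewrite (bigD1 u) /= ?(collinear_on_line yl) //.
        rewrite big1 ?addr0 => [/eqP|x /andP[yx xu]]; first by rewrite (negPf cu).
        by apply/eqP; apply: contraT => cx; have := noX x; rewrite cx xu yx.
      exists x => //; rewrite !inE cx xu !andbT.
      by apply: contraNneq zy => <-; rewrite collinear_sym.
    rewrite !inE => /andP[yu yl] /andP[y'u y'l] x [yx cx xu] [y'x _ _].
    have xl : ~~ inc x l by apply: contra xu => /only_u ->; rewrite ?cz.
    by apply: (collinear_unique_eq xl yl y'l); rewrite collinear_sym.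
  move/leq_ltn_trans; apply; rewrite [X in (_ < X)%N](cardsD1 u) (cardsD1 z (S :\ u)).
  rewrite !inE [z == u]eq_sym uz /=.
  (* The missing support point is [u] or [z]: if both values vanished, [c u = 0 = c z = kap]. *)
  have : (c u != 0) || (c z != 0).
    by rewrite -negb_and; apply: contra cu => /andP[/eqP-> /eqP<-]; rewrite czk.
  by case: (c u != 0); case: (c z != 0) => //; rewrite ?add0n ?add1n ?ltnS ?leqnSn.
(* Now [c] equals [kap] on the whole perp of [z], and [kap] is nonzero because of [x0]; any line on
   [z] lies in the support. *)
have eq_kap u : collinear z u -> c u = kap.
  move=> zu; have [->//|uz] := eqVneq u z.
  by apply/eqP; have := noU u; rewrite uz zu /= negbK.
have [l zl] : exists l, inc z l by have [l []] := collinearP _ _ (collinear_refl z); exists l.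
rewrite -(gq_points_on_line gq l); apply/subset_leq_card/subsetP => x; rewrite !inE => xl.
by rewrite (eq_kap x (collinear_on_line zl xl)) -(eq_kap x0) // cz.
Qed.

End GeneralisedQuadrangles.

(* The points not collinear with z are identified with the vectors of W, so that the lines
   not through z become cosets of n-dimensional subspaces. *)
Record affine_model (P L : finType) (inc : P -> L -> bool) (z : P) (F : finFieldType)
    (V : vectType F) (W : {vspace V}) (n : nat) (vec : P -> V) (dir : L -> {vspace V}) :
    Prop := AffineModel {
  am_vec : forall x, ~~ collinear inc z x -> vec x \in W;
  am_inj : forall x y, ~~ collinear inc z x -> ~~ collinear inc z y -> vec x = vec y -> x = y;
  am_surj : forall v, v \in W -> exists2 x, ~~ collinear inc z x & vec x = v;
  am_dim_dir : forall l, \dim (dir l) = n;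
  am_dir_sub : forall l, (dir l <= W)%VS;
  am_line : forall l, ~~ inc z l -> exists2 w, w \in W &
    forall x, ~~ collinear inc z x -> inc x l = ((vec x - w)%R \in dir l);
  am_dir_at_infinity : forall l k y, inc z k -> ~~ inc z l -> inc y k -> inc y l ->
    dir k = dir l
}.

(** * The weight bound in the presence of an affine model *)

Section AffineModel.

Import GRing.Theory.
Local Open Scope ring_scope.

Variables (P L : finType) (inc : P -> L -> bool) (s t : nat) (z : P).
Hypotheses (gq : generalised_quadrangle inc s t) (s_gt0 : (0 < s)%N) (t_gt0 : (0 < t)%N).

Variables (F : finFieldType) (V : vectType F) (W : {vspace V}) (n : nat).
Hypotheses (n_gt0 : (0 < n)%N) (n_le : (n <= \dim W)%N).

Local Notation affine x := (~~ collinear inc z x).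

Variables (vec : P -> V) (dir : L -> {vspace V}).
Hypothesis model : affine_model inc z W n vec dir.

Let vec_W := am_vec model.
Let vec_inj := am_inj model.
Let vec_surj := am_surj model.
Let dim_dir := am_dim_dir model.
Let dir_sub := am_dir_sub model.
Let affine_line := am_line model.
Let dir_at_infinity := am_dir_at_infinity model.

(** The affine points of [l] form a coset of [dir l]; a nonempty intersection with [a + D] is a
    coset of [dir l :&: D]. *)
Lemma card_line_coset l a D : ~~ inc z l -> (D <= W)%VS -> a \in W ->
  let A := [set x | [&& affine x, inc x l & vec x - a \in D]] in
  A != set0 -> #|A| = (#|F| ^ \dim (dir l :&: D))%N.
Proof.
move=> zl DW aW A /set0Pn[x0]; rewrite inE => /and3P[x0a x0l x0D].
have [w wW lE] := affine_line zl.
have x0X : vec x0 - w \in dir l by rewrite -lE.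
apply: (@card_parametrised_coset _ _ _ _ vec (vec x0)) => [x y|x|u].
- by rewrite !inE => /andP[xa _] /andP[ya _]; apply: vec_inj.
- rewrite inE => /and3P[xa]; rewrite lE // => xX xD.
  rewrite memv_cap; apply/andP; split.
    by have := memvB xX x0X; rewrite opprB addrA subrK.
  by have := memvB xD x0D; rewrite opprB addrA subrK.
rewrite memv_cap => /andP[uX uD].
have [|x xa xE] := @vec_surj (vec x0 + u).
  by rewrite memvD ?vec_W // (subvP (dir_sub l)).
exists x => //; rewrite inE xa lE // xE.
by rewrite !(addrAC (vec x0) u) (memvD x0X) ?(memvD x0D).
Qed.

Lemma line_at_infinity l : ~~ inc z l ->
  exists2 y, inc y l & forall x, inc x l -> affine x = (x != y).
Proof.
by move=> /(collinear_unique gq)[y yl yU]; exists y => // x xl; rewrite yU.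
Qed.

Lemma order_eq : s = (#|F| ^ n)%N.
Proof.
have [l0 [zl0 _]] := collinearP _ _ _ (collinear_refl gq z).
have /card_gt0P[u] : (0 < #|[set x | inc x l0] :\ z|)%N by rewrite (card_line_minus gq).
rewrite !inE => /andP[uz _]; have [l _ zl] := exists_line_avoiding gq t_gt0 uz.
have [y yl yU] := line_at_infinity zl.
rewrite -(card_line_minus gq yl) -(dim_dir l).
have [w wW lE] := affine_line zl.
(* For [D = dir l] and [a = w] the intersection is all of [l] except its one point collinear with
   [z]. *)
have AE : [set x | [&& affine x, inc x l & vec x - w \in dir l]] = [set x | inc x l] :\ y.
  apply/setP => x; rewrite !inE; have [xl|xl] := boolP (inc x l); last by rewrite !andbF.
  by rewrite yU //= andbT; case: eqP => //= /eqP xy; rewrite -lE ?yU.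
rewrite -AE card_line_coset ?capvv // AE.
by rewrite -card_gt0 (card_line_minus gq).
Qed.

Variable K : fieldType.
Hypothesis charF : #|F|%:R = 0 :> K.

Lemma order_char : s%:R = 0 :> K.
Proof. by rewrite order_eq natrX charF expr0n (gtn_eqF n_gt0). Qed.

(** For a line [k] on [z], [dir k] plays the role of the egg element. *)
Definition infinity_weight (D : {vspace V}) x : K :=
  ((x == z) || [exists k, [&& inc z k, inc x k & (dir k :&: D != 0)%VS]])%:R.

Definition coset_weight a (D : {vspace V}) x : K :=
  if collinear inc z x then infinity_weight D x else (vec x - a \in D)%:R.

Lemma infinity_weight_on_line D l x : inc z l -> inc x l -> x != z ->
  infinity_weight D x = (dir l :&: D != 0)%VS%:R.
Proof.
move=> zl xl xz; rewrite /infinity_weight (negPf xz) /=; congr (_%:R); congr nat_of_bool.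
apply/existsP/idP => [[k /and3P[zk xk]]|lD]; last by exists l; rewrite zl xl.
by rewrite (gq_partial_linear gq xz xk zk xl zl).
Qed.

Lemma coset_weight_line_sum a D l : (D <= W)%VS -> (\dim D + n = \dim W)%N -> a \in W ->
  \sum_(x | inc x l) coset_weight a D x = 1.
Proof.
move=> DW dD aW; have [zl|zl] := boolP (inc z l).
  (* On a line through [z], [z] contributes 1 and the other [s] points share one value, so they
     cancel in [K]. *)
  rewrite (bigD1 z) //= {1}/coset_weight (collinear_refl gq) /infinity_weight eqxx /=.
  rewrite (eq_bigr (fun=> (dir l :&: D != 0)%VS%:R)) => [|x /andP[xl xz]]; last first.
    by rewrite /coset_weight (collinear_on_line zl) // (infinity_weight_on_line D zl).
  rewrite sumr_const -[X in 1 + X]mulr_natr.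
  rewrite (@eq_card _ _ (mem ([set x | inc x l] :\ z))) => [|x]; last by rewrite !inE andbC.
  by rewrite (card_line_minus gq) // order_char mulr0 addr0.
have [y yl yU] := line_at_infinity zl.
have /collinearP[k [zk yk]] : collinear inc z y by rewrite -[collinear _ _ _]negbK yU ?eqxx.
have yz : y != z by apply: contraNneq zl => <-.
(* The point [y] contributes 1 exactly when [dir l] meets [D] nontrivially; the affine points
   contribute [#|A|], which is 1 in the disjoint case and 0 in [K] otherwise. *)
rewrite (bigD1 y) //= {1}/coset_weight (collinear_on_line zk yk).
rewrite (infinity_weight_on_line D zk yk yz) (dir_at_infinity zk zl yk yl).
pose A := [set x | [&& affine x, inc x l & vec x - a \in D]].
have -> : \sum_(x | inc x l && (x != y)) coset_weight a D x = #|A|%:R.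
  rewrite -sum1_card natr_sum big_mkcond [RHS]big_mkcond; apply: eq_bigr => x _ /=.
  rewrite inE; have [xl|] := boolP (inc x l); last by rewrite /= andbF.
  rewrite -yU //= /coset_weight; case: collinear => //=.
  by case: (_ \in D).
have cardA := card_line_coset zl DW aW; rewrite -/A /= in cardA.
have [lD|lD] := eqVneq (dir l :&: D)%VS 0%VS; rewrite ?add0r.
  have [w wW lE] := affine_line zl.
  have [|v /andP[vl vD]] := cosets_meet (dir_sub l) DW _ (introT eqP lD) wW aW.
    by rewrite dim_dir addnC.
  have [|x xa xE] := @vec_surj v.
    by rewrite -(subrK w v) memvD // (subvP (dir_sub l)).
  rewrite cardA; last by apply/set0Pn; exists x; rewrite inE xa lE // xE vl.
  by rewrite lD dimv0.
have [->|/cardA->] := eqVneq A set0; first by rewrite cards0 addr0.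
by rewrite natrX charF expr0n dimv_eq0 (negPf lD) addr0.
Qed.

Variables (lam : L -> K) (c : P -> K).
Hypothesis c_span : forall x, c x = \sum_l lam l * (inc x l)%:R.

Definition coset_sum a (D : {vspace V}) := \sum_(x | affine x && (vec x - a \in D)) c x.

(** The first summand does not involve [a], so [coset_sum a D] is the same for all cosets of [D]. *)
Lemma coset_sum_eq a D : (D <= W)%VS -> (\dim D + n = \dim W)%N -> a \in W ->
  \sum_(x | collinear inc z x) c x * infinity_weight D x + coset_sum a D = \sum_l lam l.
Proof.
move=> DW dD aW.
rewrite -(dual_sum c_span (fun l => coset_weight_line_sum l DW dD aW)).
rewrite [RHS](bigID (collinear inc z)) /=; congr (_ + _).
  by apply: eq_bigr => x zx; rewrite /coset_weight zx.
rewrite /coset_sum big_mkcondr; apply: eq_bigr => x /negPf zx.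
by rewrite /coset_weight zx; case: (_ \in D); rewrite ?mulr1 ?mulr0.
Qed.

Lemma perp_sum y : \sum_(x | collinear inc y x) c x = \sum_l lam l.
Proof.
rewrite -(dual_sum c_span (fun l => perp_line_sum gq y l order_char)) big_mkcond.
by apply: eq_bigr => x _; case: collinear; rewrite ?mulr1 ?mulr0.
Qed.

Lemma codeword_weight : (s <= t)%N -> (exists x, c x != 0) -> (s < #|[set x | c x != 0%R]|)%N.
Proof.
move=> s_le_t c0; set S := [set x | _]; rewrite ltnNge; apply/negP => Ss.
have sE := order_eq.
have coset_sum0 a D : (D <= W)%VS -> (\dim D + n = \dim W)%N -> a \in W -> coset_sum a D = 0.
  move=> DW dD aW; apply/eqP; apply: contraT => aD0.
  have cosetC v : v \in W -> coset_sum v D != 0.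
    move=> vW; have := coset_sum_eq DW dD aW.
    by rewrite -(coset_sum_eq DW dD vW) => /addrI <-.
  (* The complement of [D] in [W] represents each coset of [D] once, giving [#|F|^n = s] cosets. *)
  have dC : (\dim (W :\: D) = n)%N.
    by apply/eqP; rewrite -(eqn_add2l (\dim D)) dD -(dimv_cap_compl W D) (capv_idPr DW).
  have Saff : (s <= #|[set x in S | affine x]|)%N.
    rewrite sE -dC.
    apply: (@leq_card_vspace_image _ _ _ _ _ (fun v x => vec x - v \in D)) => [v vC|v w vC wC x vx wx].
      have vW := subvP (diffvSl W D) _ vC.
      have /existsP[x /and3P[xa xD cx]] :
          [exists x, [&& affine x, vec x - v \in D & c x != 0]].
        apply: contraT => /existsPn noX; case/eqP: (cosetC v vW).
        apply: big1 => x /andP[xa xD]; apply/eqP; apply: contraT => cx.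
        by have := noX x; rewrite xa xD cx.
      by exists x; rewrite ?inE ?cx.
    apply/eqP; rewrite -subr_eq0 -memv0 -(capv_diff W D) memv_cap memvB //=.
    by have := memvB wx vx; rewrite opprB addrC addrA subrK.
  (* The affine support points already exhaust the at most [s] points of [S]. *)
  have Sinf x : collinear inc z x -> c x = 0.
    move=> zx; apply/eqP; apply: contraT => cx.
    suff : (#|[set x in S | affine x]| < #|S|)%N by rewrite ltnNge (leq_trans Ss).
    apply: proper_card; apply/properP; split; first by apply/subsetP => y; rewrite inE => /andP[].
    by exists x; rewrite !inE ?zx ?andbF.
  have kap0 : \sum_l lam l = 0 by rewrite -(perp_sum z) big1.
  move: (coset_sum_eq DW dD aW); rewrite kap0 big1 ?add0r => [/eqP|x zx].
    by rewrite (negPf aD0).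
  by rewrite Sinf ?mul0r.
have [/existsP[x0 /andP[x0a cx0]]|/existsPn noX] := boolP [exists x, affine x && (c x != 0)].
  pose B := [set x in S | affine x] :\ x0.
  (* At most [s - 1] differences arise, so some [D] avoids them all; then [x0] is the only support
     point in its coset of [D]. *)
  pose r := [seq vec x - vec x0 | x <- enum B].
  have r0 : 0 \notin r.
    apply/mapP => -[x]; rewrite mem_enum !inE => /and3P[xx0 cx xa] /eqP.
    rewrite eq_sym subr_eq0 => /eqP/(vec_inj xa x0a)/eqP; exact: negP.
  have szr : (size r < #|F| ^ n)%N.
    rewrite size_map -cardE -sE; apply: leq_trans Ss.
    rewrite (cardsD1 x0 S) inE cx0 add1n ltnS; apply/subset_leq_card/subsetP => x.
    by rewrite !inE => /and3P[-> ->].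
  have [D [DW dD Dr]] := vspace_avoid szr n_le r0.
  case/eqP: cx0; rewrite -(coset_sum0 _ _ DW dD (vec_W x0a)) /coset_sum.
  rewrite (bigD1 x0) /=; last by rewrite x0a subrr mem0v.
  rewrite big1 ?addr0 // => x /andP[/andP[xa xD] xx0]; apply/eqP; apply: contraT => cx.
  suff /Dr : vec x - vec x0 \in r by rewrite xD.
  by apply: map_f; rewrite mem_enum !inE xx0 cx xa.
move: Ss; rewrite leqNgt => /negP[].
apply: (@perp_support_weight _ _ _ _ _ gq _ _ z (\sum_l lam l)) => //.
- by rewrite s_gt0.
- exact: perp_sum.
by move=> x cx; have := noX x; rewrite cx andbT negbK.
Qed.

End AffineModel.

(** * The affine model of the quadrangle of an egg *)

Section EggModel.

Import GRing.Theory.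
Local Open Scope ring_scope.

Variables (F : finFieldType) (V : vectType F) (n m : nat).
Variables (W : {vspace V}) (E : {set {vspace V}}).
Hypotheses (n_gt0 : (0 < n)%N) (m_gt0 : (0 < m)%N).
Hypotheses (dimV : \dim {:V} = (2 * n + m).+1) (eggE : egg n m W E).

Let dimW : \dim W = (2 * n + m)%N := egg_dim_ambient eggE.

Lemma egg_dim_le : (n <= m)%N.
Proof.
have q1 : (1 < #|F|)%N by apply: finNzRing_gt1.
have /card_gt2P[X [Y [Z [[XE YE ZE] [XY YZ ZX]]]]] : (2 < #|E|)%N.
  rewrite (egg_card eggE) ltnS; apply: leq_trans q1 _.
  by rewrite -[X in (X <= _)%N]expn1 leq_exp2l ?finNzRing_gt1.
have := egg_span eggE XE YE ZE XY _ YZ; rewrite eq_sym => /(_ ZX) dXYZ.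
have : (X + Y + Z <= W)%VS by rewrite !subv_add !(egg_sub eggE).
by move/dimvS; rewrite dXYZ dimW (mulnDl 2 1 n) leq_add2l mul1n.
Qed.

Lemma off_hyperplane : exists e, e \notin W.
Proof.
have /subvPn[e _ eW] : ~~ ({:V} <= W)%VS.
  by apply/negP => /dimvS; rewrite dimV dimW ltnn.
by exists e.
Qed.

Variable e : V.
Hypothesis eW : e \notin W.

(** [V] is the sum of [W] and [<[e]>], so a vector of [U] outside [W] has nonzero [e]-coefficient,
    which can be scaled to 1. *)
Lemma affine_representative (U : {vspace V}) : ~~ (U <= W)%VS ->
  exists2 w, w \in W & e + w \in U.
Proof.
case/subvPn => u uU uW.
have WeV : (W + <[e]>)%VS = fullv.
  apply/eqP; rewrite -(geq_leqif (dimv_leqif_eq (subvf _))) dimV -dimW.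
  by rewrite dim_add_vline.
have : u \in (W + <[e]>)%VS by rewrite WeV memvf.
case/memv_addP => w wW [_ /vlineP[a ->] uE].
have a0 : a != 0 by apply: contraNneq uW => a0; rewrite uE a0 scale0r addr0.
exists (a^-1 *: w); first exact: memvZ.
have -> : e + a^-1 *: w = a^-1 *: u by rewrite uE scalerDr scalerA mulVf // scale1r addrC.
exact: memvZ.
Qed.

Lemma affine_vector_notin w : w \in W -> e + w \notin W.
Proof. by move=> wW; rewrite rpredDr. Qed.

Lemma is_affine_point_vline w : w \in W -> is_affine_point W <[e + w]>%VS.
Proof.
move=> /affine_vector_notin ewW; rewrite /is_affine_point -memvE ewW dim_vline.
by rewrite (contraNneq _ ewW) // => ->; rewrite mem0v.
Qed.

Lemma affine_vline_inj v w : v \in W -> w \in W -> e + v \in <[e + w]>%VS -> v = w.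
Proof.
move=> vW wW /vlineP[a ea].
have : (1 - a) *: e \in W.
  have -> : (1 - a) *: e = a *: w - v.
    by apply/eqP; rewrite scalerBl scale1r eq_sym subr_eq addrAC ea scalerDr addrAC subrr add0r.
  by rewrite memvB ?memvZ.
rewrite rpredZeq (negPf eW) orbF subr_eq0 => /eqP a1.
by move: ea; rewrite -a1 scale1r => /addrI.
Qed.

Variables (P L : finType) (inc : P -> L -> bool) (s t : nat).
Variables (f : P -> TE_point n m W E) (g : L -> TE_line n W E).
Hypotheses (f_bij : bijective f) (g_bij : bijective g).
Hypothesis inc_fg : forall x l, TE_inc (f x) (g l) = inc x l.

Definition direction l : {vspace V} :=
  match g l with AffineLine M => (val M :&: W)%VS | EggLine X => val X end.

Lemma direction_in l : direction l \in E.
Proof. by rewrite /direction; case: (g l) => [[M Ml]|[]] //; case/andP: (Ml). Qed.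

(** With [z] the point [(oo)], the points not collinear with [z] are the affine points [<[e + w]>],
    recorded by [w]; the lines on [z] are the egg elements. *)
Lemma egg_affine_model : exists z vec, f z = InfinityPoint n m W E /\ affine_model inc z W n vec direction.
Proof.
have [f' fK f'K] := f_bij; have [g' gK g'K] := g_bij.
have f_inj := can_inj fK.
pose z := f' (InfinityPoint n m W E).
have inc_z l : inc z l = if g l is EggLine _ then true else false.
  by rewrite -inc_fg f'K; case: (g l).
have zP x : ~~ collinear inc z x = if f x is AffinePoint _ then true else false.
  case fx: (f x) => [U|[U Ut]|].
  - apply/existsPn => l; rewrite inc_z -inc_fg fx.
    by case: (g l).
  - apply/negbF/existsP.
    have /andP[_ /exists_inP[X XE /and4P[_ _ XU _]]] := Ut.
    exists (g' (EggLine n W (exist _ X XE))).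
    rewrite inc_z -inc_fg fx g'K /=; apply: subv_trans XU _; exact: capvSl.
  apply/negbF/existsP; have [X XE] : exists X, X \in E.
    by apply/card_gt0P; rewrite (egg_card eggE).
  exists (g' (EggLine n W (exist _ X XE))).
  by rewrite inc_z -inc_fg fx g'K.
have /fin_all_exists[vec vecP] (x : P) : exists v,
    if f x is AffinePoint U then v \in W /\ val U = <[e + v]>%VS else True.
  case: (f x) => [[U /= /andP[/eqP dU UW]]||]; try by exists 0.
  have [w wW ewU] := affine_representative UW; exists w; split=> //.
  apply/eqP; rewrite eq_sym -(geq_leqif (dimv_leqif_eq _)) -?memvE //.
  by have /andP[/eqP->] := is_affine_point_vline wW; rewrite dU.
exists z, vec; split; first exact: f'K.
split.
- by move=> x; rewrite zP; have := vecP x; case: (f x) => // U [].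
- move=> x y; rewrite !zP => + + exy; have := vecP x; have := vecP y; rewrite exy.
  case fx: (f x) => [U||] //; case fy: (f y) => [U'||] // [_ U'E] [_ UE] _ _.
  apply: f_inj; rewrite fx fy; congr AffinePoint; apply: val_inj.
  by rewrite UE U'E.
- move=> v vW; pose x := f' (AffinePoint n m E (exist (is_affine_point W) _ (is_affine_point_vline vW))).
  exists x; first by rewrite zP f'K.
  have := vecP x; rewrite f'K /= => -[wW E'].
  by apply/esym/affine_vline_inj => //; rewrite -E' memv_line.
- by move=> l; rewrite (egg_dim eggE) ?direction_in.
- by move=> l; rewrite (egg_sub eggE) ?direction_in.
- move=> l; rewrite inc_z /direction.
  case gl: (g l) => [[M Ml]|] //= _.
  have /andP[/eqP dM ME] := Ml.
  have [|w wW ewM] := @affine_representative M.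
    apply/negP => /capv_idPl MW.
    by have := egg_dim eggE ME; rewrite MW dM => /eqP; rewrite -[X in _ == X]addn0 -addn1 eqn_add2l.
  exists w => // x; rewrite zP -inc_fg gl; have := vecP x.
  case fx: (f x) => [U||] //= [vW ->] _.
  rewrite -memvE memv_cap (memvB vW wW) andbT.
  by rewrite -(rpredBr _ ewM) opprD addrACA subrr add0r.
move=> l k y; rewrite !inc_z -!inc_fg /direction.
case: (g k) => // -[Y YE] _; case: (g l) => // -[M Ml] _ /=.
case: (f y) => // -[U Ut] /= YU MU.
have /andP[_ ME] := Ml.
have /andP[_ /exists_inP[X XE /and4P[_ _ XU /forall_inP Xd]]] := Ut.
(* A type (ii) point contains only one egg element: another would lie in the tangent space [U :&: W]
   and also be disjoint from it, contradicting [n > 0]. *)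
have eqX Z : Z \in E -> (Z <= U)%VS -> Z = X.
  move=> ZE ZU; apply/eqP; apply: contraT => ZX.
  have /capv_idPr ZUW : (Z <= U :&: W)%VS by rewrite subv_cap ZU (egg_sub eggE).
  have := Xd Z ZE; rewrite ZX /= ZUW => /eqP Z0.
  by move: n_gt0; rewrite -(egg_dim eggE ZE) Z0 dimv0.
by rewrite (eqX Y) // (eqX _ ME) // (subv_trans (capvSl _ _)).
Qed.

Lemma egg_order_le z : f z = InfinityPoint n m W E ->
  (#|F| ^ n < #|[set l | inc z l]|)%N.
Proof.
move=> fz; have [g' _ g'K] := g_bij.
apply: (@leq_trans #|E|).
  rewrite (egg_card eggE) ltnS leq_pexp2l ?egg_dim_le //.
  exact: ltnW (finNzRing_gt1 F).
apply: (@leq_card_rel _ _ _ _ (fun X l => direction l = X)) => [X XE|X Y _ _ l -> //].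
exists (g' (EggLine n W (exist _ X XE))); last by rewrite /direction g'K.
by rewrite inE -inc_fg fz g'K.
Qed.

End EggModel.

(** * From the weight bound to the minimum distance *)

Section MinimumDistance.

Import GRing.Theory.
Local Open Scope ring_scope.

Lemma tgq_codeword_weight (P L : finType) (inc : P -> L -> bool) (s t p k : nat)
    (lam : L -> 'F_p) (c : P -> 'F_p) :
  prime p -> s = (p ^ k)%N -> translation_generalised_quadrangle inc s t ->
  (forall x, c x = \sum_l lam l * (inc x l)%:R) ->
  (exists x, c x != 0) -> (s < #|[set x | c x != 0%R]|)%N.
Proof.
move=> p_pr sE [gq [F [V [n [m [W [E [[n0 m0] dimV eggE [f [g [f_bij g_bij inc_fg]]]]]]]]]]].
have s0 : (0 < s)%N by rewrite sE expn_gt0 prime_gt0.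
have n_le : (n <= \dim W)%N by rewrite (egg_dim_ambient eggE) mul2n -addnn -addnA leq_addr.
have [e eW] := off_hyperplane dimV eggE.
have [z [vec [fz model]]] := egg_affine_model n0 dimV eggE eW f_bij g_bij inc_fg.
have qn_le_t : (#|F| ^ n <= t)%N.
  rewrite -ltnS -(gq_lines_on_point gq z).
  exact: (egg_order_le m0 eggE g_bij inc_fg fz).
have t0 : (0 < t)%N.
  by apply: leq_trans qn_le_t; rewrite expn_gt0 ltnW ?finNzRing_gt1.
have sq : s = (#|F| ^ n)%N := order_eq gq s0 t0 model.
have charF : #|F|%:R = 0 :> 'F_p.
  apply/eqP; rewrite -(dvdn_pcharf (pchar_Fp p_pr)).
  (* From [s = #|F|^n > 1] and [s = p^k] it follows that [k > 0], so [p] divides [#|F|^n] and hence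
     [#|F|]. *)
  have : (p %| #|F| ^ n)%N.
    rewrite -sq sE dvdn_exp //; have : (1 < s)%N.
      by rewrite sq -(exp1n n) ltn_exp2r ?finNzRing_gt1.
    by rewrite sE; case: k {sE}.
  by rewrite Euclid_dvdX // => /andP[].
move=> c_span; apply: (codeword_weight gq s0 t0 n0 n_le model charF c_span).
by rewrite sq.
Qed.

End MinimumDistance.

Theorem theorem4p4 (P L : finType) (inc : P -> L -> bool) (s t p : nat)
    (p_prime : prime p) (s_pow : exists k : nat, s = p ^ k)
    (tgq : translation_generalised_quadrangle inc s t) :
  is_min_distance (code_points_lines inc p) s.+1.
Proof.
have [k sE] := s_pow; have [gq [F [V [n [m [W [E [_ _ _ [f [g [[f' fK f'K] _ _]]]]]]]]]]] := tgq.
split.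
  have [l _] := collinearP _ _ _ (collinear_refl gq (f' (InfinityPoint n m W E))).
  (* The bound is attained by the row of a line, compared with the zero codeword. *)
  pose c : 'rV['F_p]_#|P| := row (enum_rank l) (incidence_matrix inc p).
  have cE : hamming_distance 0%R c = s.+1.
    rewrite -(gq_points_on_line gq l) -(card_imset _ enum_rank_inj).
    apply: eq_card => j; rewrite inE !mxE enum_rankK.
    apply/idP/imsetP => [|[x]].
      move=> cj; exists (enum_val j); rewrite ?enum_valK // inE.
      by move: cj; case: (inc _ _); rewrite ?eqxx.
    by rewrite inE => xl ->; rewrite enum_rankK xl eq_sym GRing.oner_neq0.
  exists 0%R, c; split=> //; rewrite ?inE ?sub0mx ?row_sub //.
  apply/eqP => c0; have : hamming_distance 0%R c = 0 by
    rewrite -c0; apply: eq_card0 => j; rewrite inE eqxx.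
  by rewrite cE.
move=> c1 c2; rewrite !inE => /submxP[u1 c1E] /submxP[u2 c2E] c12.
(* By linearity the distance is the weight of the difference, whose line coefficients are
   [u1 - u2]. *)
pose c x := ((c1 - c2) 0 (enum_rank x))%R.
have -> : hamming_distance c1 c2 = #|[set x | c x != 0%R]|.
  rewrite -(card_imset _ enum_rank_inj); apply: eq_card => j; rewrite inE.
  apply/idP/imsetP => [cj|[x]]; last by rewrite inE /c !mxE GRing.subr_eq0 => cx ->.
  by exists (enum_val j); rewrite ?enum_valK // inE /c enum_valK !mxE GRing.subr_eq0.
apply: (tgq_codeword_weight (lam := fun l => (u1 - u2)%R 0%R (enum_rank l)) p_prime sE tgq).
  move=> x; rewrite /c c1E c2E -mulmxBl mxE (reindex enum_rank) /=.
    by apply: eq_bigr => l _; rewrite [incidence_matrix _ _ _ _]mxE !enum_rankK.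
  exact/onW_bij/enum_rank_bij.
have [j cj] : exists j, c1 0%R j != c2 0%R j.
  by apply/existsP; apply: contraR c12 => /existsPn cc; apply/eqP/rowP => j; apply/eqP; have := cc j; rewrite negbK.
by exists (enum_val j); rewrite /c enum_valK !mxE GRing.subr_eq0.
Qed.
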